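(* The following are true. (i) For $d=2$, there exists a continuous one-parameter family $(F_\alpha)_{\alpha\in(0,1)}$ of even CDFs such that for every $\alpha\in(0,1)$: $\Psi F_\alpha=F_\alpha$, $F_\alpha(0)=\alpha$, and $\Phi'F_\alpha=SF_\alpha$ (equivalently, $\Phi F_\alpha=S^{-1}F_\alpha$). Moreover, for any $\alpha\in(0,1)$, $F_\alpha$ is the unique even CDF with these properties. (ii) For every integer $d\ge 3$, there is no CDF $F$ such that $\Psi F=F$ and $\Phi'F=SF$. (iii) For every integer $d\ge 15$, there is a CDF $F$ such that $\Psi F=F$ and $\Phi'F=RF$; indeed, the CDF $F_\infty$ of the limiting law of $V_n$ as $n\to\infty$ is such. Moreover, for all sufficiently large $d$, the fixed point $F_\infty$ is stable.
   Context: Fix $d\ge2$. A CDF here means the cumulative distribution function of an integer-valued random variable, regarded as a function $F:\mathbb{Z}\to[0,1]$. A CDF is even if it is that of a random variable supported on even integers (equivalently $F(2i)=F(2i+1)$ for all $i\in\mathbb{Z}$). Define maps on $[0,1]^{\mathbb{Z}}$ by $$(\Phi F)(i)=\Big(\tfrac{F(i-1)+F(i+1)}2\Big)^d,\qquad (\Phi'F)(i)=1-\Big(1-\tfrac{F(i-1)+F(i+1)}2\Big)^d,\qquad \Psi=\Phi\circ\Phi',$$ $(SF)(i)=F(i+1)$ and $(RF)(i)=1-F(-i-2)$. (So $S$ corresponds to $V\mapsto V-1$ and $R$ to $V\mapsto -(V+1)$ for random variables.) A family $(F_\alpha)$ is continuous if $\alpha\mapsto F_\alpha$ is continuous for weak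 convergence, i.e. $\alpha\mapsto F_\alpha(i)$ is continuous for every $i\in\mathbb{Z}$. The random variable $V_n$: on the infinite rooted $d$-ary tree $\mathbb{T}_d$ with root $\rho$, put i.i.d. cookies $X_e$ uniform on $\{-1,+1\}$ on the edges. For $n\ge0$ set $V_n(v)=0$ for vertices $v$ at height (distance from $\rho$) $2n$, and for vertices of height less than $2n$ set $V_n(v)=\max_u\{X_{uv}+V_n(u)\}$ if $v$ has even height and $V_n(v)=\min_u\{X_{uv}+V_n(u)\}$ if $v$ has odd height, where $u$ ranges over the children of $v$. Then $V_n:=V_n(\rho)$. For $d\ge15$ the law of $V_n$ converges as $n\to\infty$. The fixed point $F_\infty$ is stable if there is $\delta>0$ such that for every even CDF $F$ with $\sup_i|F(i)-F_\infty(i)|<\delta$, $\Psi^nF\to F_\infty$ weakly as $n\to\infty$. *)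

(* Defs.v *)
From HB Require Import structures.
From mathcomp Require Import all_boot all_order all_algebra.
From mathcomp Require Import all_classical all_reals all_analysis.
From mathcomp Require Import measurable_realfun.
Set Implicit Arguments.
Unset Strict Implicit.
Unset Printing Implicit Defensive.
Import Order.TTheory GRing.Theory Num.Theory.
Import numFieldNormedType.Exports.
Local Open Scope classical_set_scope.
Local Open Scope ring_scope.

(* [is_cdf_on A F]: F is the restriction to the integers of the cumulative
   distribution function of a random variable taking its values in A. *)
Definition is_cdf_on (R : realType) (A : set int) (F : int -> R) : Prop :=
  exists (disp : measure_display) (T : measurableType disp)
         (P : probability T R) (X : {RV P >-> R}),
    (forall t, exists2 i : int, A i & X t = i%:~R) /\
    (forall i : int, cdf X i%:~R = (F i)%:E).

Definition is_cdf (R : realType) (F : int -> R) : Prop := is_cdf_on setT F.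

Definition is_even_cdf (R : realType) (F : int -> R) : Prop :=
  is_cdf_on [set i : int | (2 %| i)%Z] F.

Section Maps.
Variable R : realType.
Implicit Types (d : nat) (F : int -> R).

Definition Phi d F : int -> R :=
  fun i => ((F (i - 1) + F (i + 1)) / 2) ^+ d.

Definition Phi' d F : int -> R :=
  fun i => 1 - (1 - (F (i - 1) + F (i + 1)) / 2) ^+ d.

Definition Psi d F : int -> R := Phi d (Phi' d F).

Definition S_map F : int -> R := fun i => F (i + 1).

Definition S_inv F : int -> R := fun i => F (i - 1).

Definition R_map F : int -> R := fun i => 1 - F (- i - 2).

(* For integer-valued laws, weak convergence of the laws is pointwise
   convergence of the CDFs at the integers. *)
Definition weak_cvg (Fn : nat -> int -> R) F : Prop :=
  forall i : int, Fn n i @[n --> \oo] --> F i.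

Definition stable d F : Prop :=
  exists2 delta : R, 0 < delta &
    forall G : int -> R, is_even_cdf G ->
      sup [set `|G i - F i| | i in [set: int]] < delta ->
      weak_cvg (fun n => iter n (Psi d) G) F.

(* The initial value [head 0 s] is an element of s as soon as s is nonempty,
   so that these are the genuine maximum and minimum of s. *)
Definition seq_max (s : seq R) : R := \big[Num.max/head 0 s]_(x <- s) x.
Definition seq_min (s : seq R) : R := \big[Num.min/head 0 s]_(x <- s) x.

Lemma measurable_seq_max disp (T : measurableType disp) (I : Type)
    (f : I -> T -> R) (s : seq I) :
  (forall i, measurable_fun setT (f i)) ->
  measurable_fun setT (fun t => seq_max [seq f i t | i <- s]).
Proof.
move=> mf.
have mh : measurable_fun setT (fun t => head 0 [seq f i t | i <- s]).
  by case: s => [|i s] /=.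
suff mbig (h : T -> R) : measurable_fun setT h ->
    measurable_fun setT (fun t => \big[Num.max/h t]_(i <- s) f i t).
  apply: eq_measurable_fun (mbig _ mh) => t _.
  by rewrite /seq_max big_map.
move=> {}mh; elim: s => [|i s IHs].
  by apply: eq_measurable_fun mh => t _; rewrite big_nil.
apply: eq_measurable_fun (measurable_maxr (mf i) IHs) => t _.
by rewrite big_cons.
Qed.

Lemma measurable_seq_min disp (T : measurableType disp) (I : Type)
    (f : I -> T -> R) (s : seq I) :
  (forall i, measurable_fun setT (f i)) ->
  measurable_fun setT (fun t => seq_min [seq f i t | i <- s]).
Proof.
move=> mf.
have mh : measurable_fun setT (fun t => head 0 [seq f i t | i <- s]).
  by case: s => [|i s] /=.
suff mbig (h : T -> R) : measurable_fun setT h ->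
    measurable_fun setT (fun t => \big[Num.min/h t]_(i <- s) f i t).
  apply: eq_measurable_fun (mbig _ mh) => t _.
  by rewrite /seq_min big_map.
move=> {}mh; elim: s => [|i s IHs].
  by apply: eq_measurable_fun mh => t _; rewrite big_nil.
apply: eq_measurable_fun (measurable_minr (mf i) IHs) => t _.
by rewrite big_cons.
Qed.

End Maps.

(* The vertices of the rooted d-ary tree are the finite words over 'I_d: the
   root is [::], the children of v are the words rcons v j, and the height of
   v is size v.  The edge from v to rcons v j is the pair (v, j). *)
Definition vertex (d : nat) : Type := seq 'I_d.
Definition edge (d : nat) : Type := (seq 'I_d * 'I_d)%type.

Section Cookies.
Context (R : realType) (d : nat) (disp : measure_display)
  (T : measurableType disp) (P : probability T R).
Implicit Type X : edge d -> {RV P >-> R}.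

Definition mutually_independent X : Prop :=
  forall (s : seq (edge d)) (A : edge d -> set R),
    uniq s -> (forall e, measurable (A e)) ->
    P (\bigcap_(e in [set` s]) (X e @^-1` A e)) =
    (\prod_(e <- s) P (X e @^-1` A e))%E.

Definition uniform_sign (Y : {RV P >-> R}) : Prop :=
  distribution P Y [set 1] = (2^-1)%:E /\
  distribution P Y [set -1] = (2^-1)%:E.

Definition iid_cookies X : Prop :=
  mutually_independent X /\ forall e, uniform_sign (X e).

(* [game_value X k v t] is the value at the vertex v, on the outcome t, when
   the value is 0 at the vertices located k levels below v. *)
Fixpoint game_value X (k : nat) (v : vertex d) (t : T) : R :=
  if k is k'.+1 then
    let s := [seq X (v, j) t + game_value X k' (rcons v j) t
             | j <- enum 'I_d] in
    if odd (size v) then seq_min s else seq_max s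
  else 0.

Definition V X (n : nat) (t : T) : R := game_value X n.*2 [::] t.

Lemma measurable_game_value X k v : measurable_fun setT (game_value X k v).
Proof.
elim: k v => [|k IHk] v /=; first exact: measurable_cst.
have mf j : measurable_fun setT
    (fun t => X (v, j) t + game_value X k (rcons v j) t).
  by apply: measurable_funD => //; exact: IHk.
by case: odd; [exact: measurable_seq_min | exact: measurable_seq_max].
Qed.

Lemma measurable_V X n : measurable_fun setT (V X n).
Proof. exact: measurable_game_value. Qed.

HB.instance Definition _ X n :=
  isMeasurableFun.Build _ _ T R (V X n) (measurable_V X n).

Definition cdf_V X (n : nat) (i : int) : R :=
  fine (cdf (V X n : {RV P >-> R}) i%:~R).

End Cookies.

(* F is the CDF of the limit of the laws of V_n. The law of V_n does not depend
   on the probability space carrying the cookies. *)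
Definition is_limiting_cdf (R : realType) (d : nat) (F : int -> R) : Prop :=
  is_cdf F /\
  forall (disp : measure_display) (T : measurableType disp)
         (P : probability T R) (X : edge d -> {RV P >-> R}),
    iid_cookies X -> weak_cvg (cdf_V X) F.

(* Main.v *)
(* (i), (ii): writing x = F (i - 1), y = F (i + 1) and s = (x + y) / 2, the
   equations Psi F = F and Phi' F = S F give x = s ^ d and 1 - y = (1 - s) ^ d.
   For d = 2 each of these equations implies the other one, and y is then the
   function 2 sqrt x - x of x, whose orbits are the required CDFs.  For d >= 3
   they imply s ^ d - (1 - s) ^ d = 2 s - 1, hence s is 0, 1/2 or 1, which
   forces F (i - 1) = F (i + 1) for all i.
   (iii): Psi is the square of Q = R o Phi', whose fixed points are the F such
   that Phi' F = R F.  On functions close to the Heaviside step function, Q is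
   a contraction for a weighted sup norm.  The law of V_n is the 2n-th iterate
   of Q at the step function, hence converges to the fixed point of Q, and so
   do the iterates from any F close to this fixed point. *)
Require Import Defs.
From HB Require Import structures.
From mathcomp Require Import all_boot all_order all_algebra.
From mathcomp Require Import all_classical all_reals all_analysis.
From mathcomp Require Import measurable_realfun ring lra zify.
Set Implicit Arguments.
Unset Strict Implicit.
Unset Printing Implicit Defensive.
Import Order.TTheory GRing.Theory Num.Theory.
Import numFieldNormedType.Exports.
Local Open Scope classical_set_scope.
Local Open Scope ring_scope.

(** * CDFs on the integers *)

(** These conditions characterize the CDFs of integer-valued laws; by monotonicity, one index for
    each [e] encodes the limits 0 and 1. *)
Definition cdf_shape (R : realType) (F : int -> R) : Prop :=
  [/\ {homo F : i j / i <= j}, forall i, 0 <= F i <= 1,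
      forall e, 0 < e -> exists i, F i < e &
      forall e, 0 < e -> exists i, 1 - e < F i].

Lemma is_cdf_on_shape (R : realType) A (F : int -> R) :
  is_cdf_on A F -> cdf_shape F.
Proof.
move=> [disp [T [P [X [_ FX]]]]].
have FE i : F i = fine (cdf X i%:~R) by rewrite FX.
have F01 i : 0 <= F i <= 1 by rewrite -!lee_fin -FX cdf_ge0 cdf_le1.
have Fmono : {homo F : i j / i <= j}.
  by move=> i j ij; rewrite -lee_fin -!FX cdf_nondecreasing// ler_int.
split=> // e e0.
- have /fine_cvgP[_] := cvg_cdfNy0 X.
  move=> /cvgrPdist_lt/(_ _ e0)[M [_ MP]].
  (* The threshold at -oo is strict, so the integer must lie strictly below [M]. *)
  exists (Num.floor M - 1); have := MP (Num.floor M - 1)%:~R.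
  rewrite /= -FE sub0r normrN ger0_norm; last by case/andP: (F01 (Num.floor M - 1)).
  by apply; rewrite intrB ltrBlDr (le_lt_trans (floor_le _))// ltrDl.
- have /fine_cvgP[_] := cvg_cdfy1 X.
  move=> /cvgrPdist_lt/(_ _ e0)[M [_ MP]].
  exists (Num.floor M + 1); have := MP (Num.floor M + 1)%:~R.
  rewrite /= -FE ger0_norm; last by rewrite subr_ge0; case/andP: (F01 (Num.floor M + 1)).
  by rewrite ltrBlDl -ltrBlDr; apply; rewrite floorD1_gt.
Qed.

(** No even integer lies in ]2i, 2i + 1], so the two events coincide. *)
Lemma even_cdf_pair (R : realType) (F : int -> R) (i : int) :
  is_even_cdf F -> F (2 * i + 1) = F (2 * i).
Proof.
move=> [disp [T [P [X [X2 FX]]]]]; apply: EFin_inj; rewrite -!FX /cdf/=.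
congr (P _); apply/seteqP; split=> t /=; rewrite !in_itv/=;
  have [j /= j2 ->] := X2 t; rewrite !ler_int; lia.
Qed.

(** * Realization of functions on the integers as CDFs *)

Section StepCumulative.
Variables (R : realType) (F : int -> R).
Hypothesis F_shape : cdf_shape F.

Definition step_fun (x : R) : R := F (Num.floor x).

Lemma step_fun_nondecreasing : {homo step_fun : x y / x <= y}.
Proof. by case: F_shape => Fm _ _ _ x y xy; apply: Fm; exact: le_floor. Qed.

Lemma step_fun_right_continuous : right_continuous step_fun.
Proof.
move=> x; apply: cvg_near_cst; near=> y.
rewrite /step_fun; congr F; apply: floor_def.
apply/andP; split.
  by apply: (le_trans (floor_le x)); apply/ltW; near: y; exact: nbhs_right_gt.
by near: y; apply: nbhs_right_lt; rewrite floorD1_gt.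
Unshelve. all: by end_near. Qed.

Lemma step_funNy : step_fun @ -oo --> (0 : R).
Proof.
case: F_shape => Fm F01 FN _; apply/cvgrPdist_lt => e /FN[i ie].
near=> x; rewrite sub0r normrN ger0_norm; last by case/andP: (F01 (Num.floor x)).
apply: le_lt_trans ie; rewrite /step_fun; apply: Fm.
rewrite -(ler_int R); apply: (le_trans (floor_le x)).
by near: x; apply: nbhs_ninfty_le; rewrite num_real.
Unshelve. all: by end_near. Qed.

Lemma step_funy : step_fun @ +oo --> (1 : R).
Proof.
case: F_shape => Fm F01 _ FP; apply/cvgrPdist_lt => e /FP[i ie].
near=> x.
rewrite ger0_norm; last by rewrite subr_ge0; case/andP: (F01 (Num.floor x)).
rewrite ltrBlDl -ltrBlDr; apply: (lt_le_trans ie); apply: Fm.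
rewrite floor_ge_int.
by near: x; apply: nbhs_pinfty_ge; rewrite num_real.
Unshelve. all: by end_near. Qed.

HB.instance Definition _ := isCumulative.Build R _ R step_fun
  step_fun_nondecreasing step_fun_right_continuous.
HB.instance Definition _ :=
  isCumulativeBounded.Build R 0 1 step_fun step_funNy step_funy.

(* Under the Lebesgue-Stieltjes law of the step function x |-> F (floor x),
   the variable x |-> m * ceil (x / m) has CDF F on the multiples of m. *)
Lemma cdf_shape_is_cdf_on (m : int) :
  0 < m -> (forall i, F (m * (i %/ m)%Z) = F i) ->
  is_cdf_on [set i : int | (m %| i)%Z] F.
Proof.
move=> m0 Fm.
have mR0 : 0 < m%:~R :> R by rewrite ltr0z.
pose g (x : measurableTypeR R) : R := (m * Num.ceil (x / m%:~R))%:~R.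
have mg : measurable_fun setT g.
  apply: nondecreasing_measurable => //= x y xy.
  rewrite ler_int ler_pM2l//; apply: le_ceil.
  by rewrite ler_pM2r// invr_gt0.
pose gi := isMeasurableFun.Build _ _ _ _ g mg.
pose X : {mfun measurableTypeR R >-> R} := HB.pack g gi.
exists _, _, (lebesgue_stieltjes_measure step_fun), X; split.
  by move=> t; exists (m * Num.ceil (t / m%:~R)) => //=; rewrite dvdz_mulr.
move=> i; rewrite -Fm.
have <- : step_fun (m * (i %/ m)%Z)%:~R = F (m * (i %/ m)%Z).
  by rewrite /step_fun intrKfloor.
rewrite -cdf_lebesgue_stieltjes_id /cdf/=; congr (lebesgue_stieltjes_measure _ _).
(* Rounding [x] up to a multiple of [m] stays below [i] exactly when [x] is at most the largest
   multiple of [m] not exceeding [i]. *)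
have E (x : R) :
    (x <= (m * (i %/ m)%Z)%:~R) = ((m * Num.ceil (x / m%:~R))%:~R <= i%:~R :> R).
  by rewrite ler_int [in RHS]mulrC -lez_divRL// ceil_le_int ler_pdivrMr// -intrM mulrC.
by apply/seteqP; split=> x /=; rewrite !in_itv/= E.
Qed.

End StepCumulative.

Lemma cdf_shape_is_cdf (R : realType) (F : int -> R) : cdf_shape F -> is_cdf F.
Proof.
move=> /cdf_shape_is_cdf_on/(_ 1)[//|i|disp [T [P [X [X1 FX]]]]].
  by rewrite divz1 mul1r.
by exists disp, T, P, X; split=> // t; have [i _ Xi] := X1 t; exists i.
Qed.

Lemma expr_arbitrarily_small (R : realType) (r e : R) :
  0 <= r < 1 -> 0 < e -> exists n, r ^+ n < e.
Proof.
move=> /andP[r0 r1] e0.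
have /cvgrPdist_lt/(_ _ e0)[n _ /(_ n (leqnn n))/=] :
  r ^+ k @[k --> \oo] --> (0 : R) by apply: cvg_expr; rewrite ger0_norm.
by rewrite sub0r normrN ger0_norm ?exprn_ge0// => rn; exists n.
Qed.

(** * The fixed points with Phi' F = S F *)

(** With [s = (x + y) / 2], expanding [1 - (1 - s) ^+ 2 = y] and cancelling [y] leaves
    [s ^+ 2 = x]. *)
Lemma Phi'2_S_mapE (R : realType) (G : int -> R) :
  Phi' 2 G = S_map G <-> Phi 2 G = S_inv G.
Proof.
by rewrite !funeqE; split=> E i; move: (E i);
  rewrite /Phi /Phi' /S_map /S_inv; set x := G (i - 1); set y := G (i + 1);
  move=> xy; nra.
Qed.

(** The shift commutes with [Phi]. *)
Lemma Psi_S_map_Phi (R : realType) d (F : int -> R) :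
  Phi' d F = S_map F -> Psi d F = S_map (Phi d F).
Proof.
move=> FS; rewrite /Psi FS; apply/funext => i.
by rewrite /Phi /S_map -!addrA !(addrC _ 1) !(addrC 1 (-1)).
Qed.

(** * The case d = 2: orbits of the square-root map *)

Section SquareRootFlow.
Variable R : realType.
Implicit Types (x y a : R) (F G : int -> R).

(* For d = 2 and s = (x + y) / 2, the equation x = s ^ 2 for x = F (i - 1) and
   y = F (i + 1) solves to y = up x; the reflection x |-> 1 - x conjugates up
   to its inverse. *)
Definition up x : R := 2 * Num.sqrt x - x.
Definition down x : R := 1 - up (1 - x).

(** The distance to 1 becomes a perfect square: this gives both the inverse of [up] and the
    convergence of its orbits to 1. *)
Lemma upE x : 0 <= x -> 1 - up x = (1 - Num.sqrt x) ^+ 2.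
Proof. by move=> x0; rewrite /up sqrrB expr1n mul1r sqr_sqrtr//; lra. Qed.

Lemma up_continuous : continuous up.
Proof.
move=> x; apply: (@cvgB _ R^o); last exact: cvg_id.
by apply: (@cvgM R R^o); [exact: cvg_cst|exact: sqrt_continuous].
Qed.

Lemma sqrt_itv x : 0 < x < 1 -> 0 < Num.sqrt x < 1.
Proof. by move=> /andP[x0 x1]; rewrite sqrtr_gt0 x0 -sqrtr1 ltr_sqrt//= x1. Qed.

Lemma up_itv x : 0 < x < 1 -> 0 < up x < 1.
Proof.
move=> x01; have /andP[s0 s1] := sqrt_itv x01.
have /andP[x0 _] := x01; have := sqr_sqrtr (ltW x0); rewrite /up; nra.
Qed.

Lemma le_up x : 0 < x < 1 -> x <= up x.
Proof.
move=> x01; have /andP[s0 s1] := sqrt_itv x01.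
have /andP[x0 _] := x01; have := sqr_sqrtr (ltW x0); rewrite /up; nra.
Qed.

Lemma iter_up_itv n x : 0 < x < 1 -> 0 < iter n up x < 1.
Proof. by move=> x01; elim: n => //= n; exact: up_itv. Qed.

Lemma iter_up_ge n x : 0 < x < 1 -> x <= iter n up x.
Proof.
move=> x01; elim: n => //= n /le_trans; apply; apply: le_up; exact: iter_up_itv.
Qed.

(** If [y] is the n-th iterate and [t] its square root, the next distance to 1 is [(1 - t) ^+ 2].
    One factor is at most [1 - Num.sqrt x] because [x <= y], the other at most [1 - y] because
    [t ^+ 2 <= t]. *)
Lemma iter_up_le_expr n x :
  0 < x < 1 -> 1 - iter n up x <= (1 - Num.sqrt x) ^+ n.
Proof.
move=> x01; have /andP[s0 s1] := sqrt_itv x01.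
elim: n => [|n IHn] /=; first by have /andP[] := x01; rewrite expr0; lra.
have y01 := iter_up_itv n x01; have /andP[y0 y1] := y01.
have /andP[t0 t1] := sqrt_itv y01.
rewrite (upE (ltW y0)) expr2 exprS ler_pM//; try lra.
- by rewrite lerD2l lerN2 ler_wsqrtr// iter_up_ge.
- by apply: le_trans IHn; have := sqr_sqrtr (ltW y0); nra.
Qed.

Lemma iter_up_near1 x e : 0 < x < 1 -> 0 < e -> exists n, 1 - iter n up x < e.
Proof.
move=> x01 e0; have /andP[s0 s1] := sqrt_itv x01.
have [n sn] := @expr_arbitrarily_small R (1 - Num.sqrt x) e ltac:(lra) e0.
by exists n; apply: le_lt_trans sn; exact: iter_up_le_expr.
Qed.

Lemma half_square_up x y : 0 <= x -> 0 <= y ->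
  x = ((x + y) / 2) ^+ 2 -> y = up x.
Proof.
move=> x0 y0 xE; have {xE} : Num.sqrt x = (x + y) / 2.
  by rewrite {1}xE sqrtr_sqr ger0_norm//; lra.
by rewrite /up => ->; lra.
Qed.

(** The equation is invariant under the exchange of [(x, y)] and [(1 - y, 1 - x)]. *)
Lemma half_square_down x y : x <= 1 -> y <= 1 ->
  x = ((x + y) / 2) ^+ 2 -> x = down y.
Proof.
move=> x1 y1 xE; rewrite /down -(@half_square_up (1 - y) (1 - x)); lra.
Qed.

Lemma downK x : 0 < x < 1 -> up (down x) = x.
Proof.
move=> /andP[x0 x1]; rewrite [in LHS]/down.
have y01 : 0 < 1 - x < 1 by lra.
rewrite (upE (ltW (andP y01).1)) /up sqrtr_sqr.
have /andP[s0 s1] := sqrt_itv y01.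
rewrite ger0_norm; last lra.
have := sqr_sqrtr (ltW (andP y01).1); nra.
Qed.

(** Negative times follow [down], the conjugate of [up] by [x |-> 1 - x]; [Negz n] is [-(n + 1)],
    whence the [n.+1] iterates. *)
Definition up_orbit a (k : int) : R :=
  match k with
  | Posz n => iter n up a
  | Negz n => 1 - iter n.+1 up (1 - a)
  end.

Lemma up_orbit_itv a k : 0 < a < 1 -> 0 < up_orbit a k < 1.
Proof.
move=> a01; case: k => n; rewrite [up_orbit _ _]/=; first exact: iter_up_itv.
have : 0 < 1 - a < 1 by lra.
by move=> /(iter_up_itv n.+1); rewrite [iter _ _ _]/=; lra.
Qed.

Lemma up_orbitN a n : up_orbit a (- n%:Z) = 1 - iter n up (1 - a).
Proof. by case: n => [|n] /=; [rewrite subKr|]. Qed.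

Lemma up_orbitD1 a k : 0 < a < 1 -> up_orbit a (k + 1) = up (up_orbit a k).
Proof.
move=> a01; case: k => n; first by rewrite -PoszD addn1.
have -> : Negz n + 1 = - n%:Z by lia.
have b01 : 0 < 1 - a < 1 by lra.
have /andP[y0 y1] := iter_up_itv n b01.
rewrite up_orbitN /up_orbit iterS.
rewrite -[in LHS](@downK (1 - iter n up (1 - a))); last lra.
by rewrite /down subKr.
Qed.

Lemma up_orbitB1 a k : 0 < a < 1 -> up_orbit a (k - 1) = down (up_orbit a k).
Proof.
move=> a01; have xy := up_orbitD1 (k - 1) a01; rewrite subrK in xy.
have x01 := up_orbit_itv (k - 1) a01; have y01 := up_orbit_itv k a01.
apply: half_square_down; try lra.
have /andP[x0 _] := x01.
by rewrite xy /up -[LHS](sqr_sqrtr (ltW x0)); congr (_ ^+ 2); lra.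
Qed.

Lemma up_orbit_nondecreasing a : 0 < a < 1 -> {homo up_orbit a : i j / i <= j}.
Proof.
move=> a01 i j ij; have -> : j = i + `|j - i|%N%:Z by lia.
elim: `|j - i|%N => [|n IHn]; first by rewrite addr0.
rewrite -addn1 PoszD addrA up_orbitD1//; apply: (le_trans IHn).
by apply: le_up; exact: up_orbit_itv.
Qed.

Lemma up_orbit_shape a : 0 < a < 1 -> cdf_shape (up_orbit a).
Proof.
move=> a01; split; first exact: up_orbit_nondecreasing.
- by move=> i; have := up_orbit_itv i a01; lra.
- move=> e e0; have b01 : 0 < 1 - a < 1 by lra.
  have [n ne] := iter_up_near1 b01 e0.
  by exists (- n%:Z); rewrite up_orbitN.
- move=> e e0; have [n ne] := iter_up_near1 a01 e0.
  by exists n%:Z => /=; lra.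
Qed.

Lemma cdf_shape_half F : cdf_shape F -> cdf_shape (fun i => F (i %/ 2)%Z).
Proof.
move=> [Fm F01 FN FP]; split=> //.
- by move=> i j ij; apply: Fm; lia.
- by move=> e /FN[i ie]; exists (2 * i); rewrite mulKz.
- by move=> e /FP[i ie]; exists (2 * i); rewrite mulKz.
Qed.

(** The halves of [i - 1] and [i + 1] are consecutive, and the mean of [x] and [up x] is the square
    root of [x]. *)
Lemma up_orbit_half_Phi a (F := fun i => up_orbit a (i %/ 2)%Z) : 0 < a < 1 ->
  Phi 2 F = S_inv F.
Proof.
move=> a01; apply/funext => i; rewrite /Phi /S_inv /F.
have -> : ((i + 1) %/ 2)%Z = ((i - 1) %/ 2)%Z + 1 by lia.
rewrite up_orbitD1//; set x := up_orbit _ _.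
have /andP[x0 _] : 0 < x < 1 by exact: up_orbit_itv.
by rewrite -[RHS](sqr_sqrtr (ltW x0)) /up; congr (_ ^+ 2); lra.
Qed.

(** At the odd sites [2 * k + 1] and [2 * k - 1] the equation determines the two even neighbours of
    [2 * k], so the value at 0 fixes all even values; evenness gives the odd ones. *)
Lemma even_S_inv_up_orbit G a : 0 < a < 1 -> is_even_cdf G -> G 0 = a ->
  Phi 2 G = S_inv G -> G = fun i => up_orbit a (i %/ 2)%Z.
Proof.
move=> a01 Gev Ga; rewrite [X in X -> _]funeqE => GE.
have [_ G01 _ _] := is_cdf_on_shape Gev.
have GD k : G (2 * (k + 1)) = up (G (2 * k)).
  have := GE (2 * k + 1); rewrite /Phi /S_inv addrK.
  have -> : 2 * k + 1 + 1 = 2 * (k + 1) :> int by lia.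
  move=> E; apply: half_square_up => //; by case/andP: (G01 (2 * k)); case/andP: (G01 (2 * (k + 1))).
have GB k : G (2 * (k - 1)) = down (G (2 * k)).
  have := GE (2 * k - 1); rewrite /Phi /S_inv subrK.
  have -> : 2 * k - 1 - 1 = 2 * (k - 1) :> int by lia.
  move=> E; apply: half_square_down => //; by case/andP: (G01 (2 * k)); case/andP: (G01 (2 * (k - 1))).
have GO k : G (2 * k) = up_orbit a k.
  elim/int_ind: k => [|n IHn|n IHn]; first by rewrite mulr0 Ga.
  - have -> : n.+1%:Z = n%:Z + 1 by lia.
    by rewrite GD up_orbitD1// IHn.
  - have -> : - n.+1%:Z = - n%:Z - 1 by lia.
    by rewrite GB up_orbitB1// IHn.
apply/funext => i; rewrite -GO.
have [->|->] : i = 2 * (i %/ 2)%Z \/ i = 2 * (i %/ 2)%Z + 1 by lia.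
  by rewrite mulKz.
by rewrite even_cdf_pair//; congr (G (2 * _)); lia.
Qed.

End SquareRootFlow.

Lemma continuous_up_orbit (R : realType) k : continuous (up_orbit (R := R) ^~ k).
Proof.
have iter_cont n : continuous (iter n (@up R)).
  elim: n => [|n IHn] x; first exact: cvg_id.
  by apply: (@continuous_comp _ _ _ (iter n (@up R)) (@up R)); [exact: IHn|exact: up_continuous].
case: k => n; first exact: iter_cont.
move=> x; apply: (@cvgB _ R^o); first exact: cvg_cst.
apply: (@continuous_comp _ _ _ (fun x : R => 1 - x) (iter n.+1 (@up R))); last exact: iter_cont.
by apply: (@cvgB _ R^o); [exact: cvg_cst|exact: cvg_id].
Qed.

(** * Nonexistence for d >= 3 *)

(** For [d = 3] the left side is [(u - v) * (1 - u * v)]. Inductively,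
    [u * (u ^+ n - v ^+ n) + v ^+ n * (u - v)] is less than [(u + v) * (u - v)], since
    [v ^+ n <= v]. *)
Lemma expr_gap (R : realType) (d : nat) (u v : R) :
  (3 <= d)%N -> 0 < v -> v < u -> u + v = 1 -> u ^+ d - v ^+ d < u - v.
Proof.
move=> d3 v0 vu uv; rewrite -(subnK d3); elim: (d - 3)%N => [|k IHk].
  have : 0 < (u - v) * (u * v) by rewrite !mulr_gt0; lra.
  have -> : u = 1 - v by lra.
  by rewrite add0n !exprS expr0; lra.
rewrite addSn !exprS; set n := (k + 3)%N in IHk *.
have vn : v ^+ n <= v.
  by rewrite -[leRHS]expr1 ler_wiXn2l ?ltW// /n; [lra|rewrite addn3].
have -> : u * u ^+ n - v * v ^+ n = u * (u ^+ n - v ^+ n) + v ^+ n * (u - v).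
  by ring.
nra.
Qed.

Lemma expr_gap_roots (R : realType) (d : nat) (s : R) : (3 <= d)%N ->
  0 <= s <= 1 -> s ^+ d - (1 - s) ^+ d = 2 * s - 1 ->
  [\/ s = 0, s = 2^-1 | s = 1].
Proof.
move=> d3 /andP[s0 s1] E.
have [->|s0'] := eqVneq s 0; first exact: Or31.
have [->|s1'] := eqVneq s 1; first exact: Or33.
have {}s0 : 0 < s by rewrite lt0r s0' s0.
have {}s1 : s < 1 by rewrite lt_neqAle s1' s1.
apply: Or32; have [h|h|->//] := ltgtP s 2^-1; exfalso.
- by have := @expr_gap _ d (1 - s) s d3 s0; lra.
- by have := @expr_gap _ d s (1 - s) d3; lra.
Qed.

Lemma no_cdf_fixed_S_map (R : realType) (d : nat) (F : int -> R) :
  (3 <= d)%N -> cdf_shape F -> Psi d F = F -> Phi' d F = S_map F -> False.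
Proof.
move=> d3 [Fm F01 FN FP] FPsi FS.
have FPhi i : Phi d F i = F (i - 1).
  have := Psi_S_map_Phi FS; rewrite FPsi => /(congr1 (@^~ (i - 1))).
  by rewrite /S_map subrK.
have d0 : d = d.-1.+1 by rewrite prednK// (leq_trans _ d3).
have half_le : (2^-1 : R) ^+ d <= 8^-1.
  have -> : (8^-1 : R) = 2^-1 ^+ 3 by rewrite !exprS expr0; lra.
  by rewrite ler_wiXn2l//; lra.
have half_gt : 0 < (2^-1 : R) ^+ d by rewrite exprn_gt0//; lra.
have roots i : [\/ F (i - 1) = 0 /\ F (i + 1) = 0,
    F (i - 1) = 2^-1 ^+ d /\ F (i + 1) = 1 - 2^-1 ^+ d |
    F (i - 1) = 1 /\ F (i + 1) = 1].
  have := FPhi i; have := congr1 (@^~ i) FS; rewrite /Phi /Phi' /S_map.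
  have := F01 (i - 1); have := F01 (i + 1).
  set s := (F (i - 1) + F (i + 1)) / 2 => F0 F1 <- <-.
  have s01 : 0 <= s <= 1 by rewrite /s; lra.
  have sE : s ^+ d - (1 - s) ^+ d = 2 * s - 1.
    by have := FPhi i; have := congr1 (@^~ i) FS; rewrite /Phi /Phi' /S_map -/s; rewrite /s; lra.
  case: (expr_gap_roots d3 s01 sE) => ->.
  - by apply: Or31; rewrite subr0 expr1n subrr d0 expr0n.
  - by apply: Or32; split=> //; congr (1 - _ ^+ _); lra.
  - by apply: Or33; rewrite subrr expr1n d0 expr0n/= subr0.
(* The middle case is impossible: the pair at [i + 2] would start with [1 - 2^-1 ^+ d], which the
   bounds on [2^-1 ^+ d] separate from 0, [2^-1 ^+ d] and 1. *)
have F2 i : F (i - 1) = F (i + 1).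
  have := roots i; have := roots (i + 1 + 1); rewrite addrK.
  by case=> -[? ?]; case=> -[? ?]; lra.
have Fper i n : F (i + 2 * n%:Z) = F i.
  elim: n => [|n <-]; first by rewrite mulr0 addr0.
  have -> : i + 2 * n.+1%:Z = i + 2 * n%:Z + 1 + 1 by lia.
  by rewrite -F2 addrK.
(* Period 2 and monotonicity bound a value above 1/2 by one below 1/2. *)
have [i ilt] := FN 2^-1 ltac:(lra); have [j jlt] := FP 2^-1 ltac:(lra).
have : F j <= F (i + 2 * `|j - i|%N%:Z) by apply: Fm; lia.
by rewrite Fper; lra.
Qed.

(** * The contraction R o Phi' *)

Lemma expr_lipschitz (R : realType) (M x y : R) n :
  0 <= x <= M -> 0 <= y <= M ->
  `|x ^+ n.+1 - y ^+ n.+1| <= n.+1%:R * M ^+ n * `|x - y|.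
Proof.
move=> /andP[x0 xM] /andP[y0 yM]; have M0 : 0 <= M by exact: le_trans xM.
elim: n => [|n IHn]; first by rewrite !expr1 expr0 !mul1r.
have -> : x ^+ n.+2 - y ^+ n.+2 =
    x * (x ^+ n.+1 - y ^+ n.+1) + y ^+ n.+1 * (x - y) by rewrite !exprS; ring.
apply: (le_trans (ler_normD _ _)); rewrite !normrM.
rewrite (ger0_norm x0) (ger0_norm (exprn_ge0 _ y0)) -natr1 !mulrDl mul1r.
apply: lerD; last by rewrite ler_wpM2r// lerXn2r// nnegrE.
rewrite (_ : _ * _ * _ = M * (n.+1%:R * M ^+ n * `|x - y|)); last by rewrite exprS; ring.
by rewrite ler_pM.
Qed.

(** Bernoulli's inequality, as the Lipschitz bound between 1 and [1 - x]. *)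
Lemma one_sub_expr_le (R : realType) (x : R) n :
  0 <= x <= 1 -> 1 - (1 - x) ^+ n <= n%:R * x.
Proof.
case: n => [|n] x01; first by rewrite expr0 subrr mul0r.
have := @expr_lipschitz R 1 1 (1 - x) n; rewrite !expr1n mulr1 subKr.
move=> /(_ _ _)/(le_trans (ler_norm _)); rewrite (ger0_norm (x := x)); last lra.
by apply; lra.
Qed.

Section ReflectedMap.
Variables (R : realType) (d : nat).
Implicit Types (F G : int -> R).

Lemma R_mapK : involutive (@R_map R).
Proof.
by move=> F; apply/funext => i; rewrite /R_map subKr; congr F; lia.
Qed.

(* R conjugates Phi to Phi', so that Psi is the square of Q = R o Phi'. *)
Definition Q F : int -> R := R_map (Phi' d F).

Lemma QE F i : Q F i = (1 - (F (- i - 3) + F (- i - 1)) / 2) ^+ d.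
Proof.
rewrite /Q /R_map /Phi' subKr.
have -> : - i - 2 - 1 = - i - 3 :> int by lia.
by have -> : - i - 2 + 1 = - i - 1 :> int by lia.
Qed.

Lemma Psi_QQ F : Psi d F = Q (Q F).
Proof.
apply/funext => i; rewrite QE /Q /R_map /Psi /Phi; congr (_ ^+ d).
have -> : - (- i - 3) - 2 = i + 1 :> int by lia.
have -> : - (- i - 1) - 2 = i - 1 :> int by lia.
by lra.
Qed.

Lemma iter_Psi n F : iter n (Psi d) F = iter n.*2 Q F.
Proof. by elim: n => //= n ->; rewrite Psi_QQ. Qed.

Lemma Q_itv F : (forall i, 0 <= F i <= 1) -> forall i, 0 <= Q F i <= 1.
Proof.
move=> F01 i; rewrite QE; have := F01 (- i - 3); have := F01 (- i - 1) => ? ?.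
by rewrite exprn_ge0 ?exprn_ile1//; lra.
Qed.

Lemma Q_nondecreasing F : (forall i, 0 <= F i <= 1) ->
  {homo F : i j / i <= j} -> {homo Q F : i j / i <= j}.
Proof.
move=> F01 Fm i j ij; rewrite !QE.
have := F01 (- i - 3); have := F01 (- i - 1).
have := F01 (- j - 3); have := F01 (- j - 1) => ? ? ? ?.
have h1 : F (- j - 3) <= F (- i - 3) by apply: Fm; lia.
have h2 : F (- j - 1) <= F (- i - 1) by apply: Fm; lia.
by rewrite lerXn2r ?nnegrE//; lra.
Qed.

Let eps : R := 2^-1 ^+ d.

(* Near the law of V_n, F is of order 2^-d at the negative integers, and its
   image under Q is of order d 2^-d away from 1 at the others. *)
Definition box (c : R) F : Prop :=
  [/\ forall i, 0 <= F i <= 1, forall i, i < 0 -> F i <= c * eps &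
      forall i, 0 <= i -> 1 - F i <= c * d%:R * eps].

(* Q multiplies by d the distances passed from i < 0 to i >= 0, and by about
   d 2^-d the other ones: the weight 2 d makes it a contraction by 1/2. *)
Definition weighted_close (D : R) F G : Prop :=
  (forall i, i < 0 -> `|F i - G i| <= D / (2 * d%:R)) /\
  (forall i, 0 <= i -> `|F i - G i| <= D).

Hypothesis d15 : (15 <= d)%N.

Let dR : 15 <= d%:R :> R.
Proof. by rewrite (ler_nat R 15). Qed.

Let eps_gt0 : 0 < eps.
Proof. by rewrite exprn_gt0//; lra. Qed.

(** The smallness estimate behind the contraction. At 15 it reads 3600 <= 32768, and each induction
    step uses [(d + 1) ^ 2 <= 2 * d ^ 2]. *)
Lemma sqr_eps_small : 16 * (d%:R ^+ 2) * eps <= 1.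
Proof.
have d2 : (16 * d ^ 2 <= 2 ^ d)%N.
  rewrite -(subnK d15); elim: (d - 15)%N => // n IHn.
  rewrite addSn [leqRHS]expnS; apply: leq_trans (leq_mul (leqnn 2) IHn).
  by rewrite !expnS !expn0; nia.
rewrite /eps exprVn ler_pdivrMr ?exprn_gt0// mul1r.
by rewrite -!natrX -natrM ler_nat.
Qed.

(** The bound that [box 4] puts on [1 - F] at the nonnegative integers. *)
Let eta : R := 4 * d%:R * eps.

Let eta_ge0 : 0 <= eta.
Proof. by rewrite /eta; have := eps_gt0; have := dR; nra. Qed.

Let deta : d%:R * eta <= 4^-1.
Proof. by have := sqr_eps_small; rewrite /eta expr2; lra. Qed.

Let M : R := (1 + eta) / 2.

(** [(1 + eta) ^+ d] is at most the inverse of [(1 - eta) ^+ d], which Bernoulli's inequality bounds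
    below by 3/4. *)
Let M_expr : M ^+ d <= 2 * eps.
Proof.
have eta1 : eta <= 1 by have := deta; have := eta_ge0; have := dR; nra.
have h : (1 + eta) ^+ d * (1 - eta) ^+ d <= 1.
  have := eta_ge0 => ?.
  by rewrite -exprMn exprn_ile1//; nra.
have := @one_sub_expr_le R eta d; rewrite eta_ge0 eta1 => /(_ isT) h2.
have h3 : (1 + eta) ^+ d <= 2.
  have := deta; have : 1 <= (1 + eta) ^+ d by rewrite exprn_ege1// lerDl eta_ge0.
  by move: h h2; set u := (1 + eta) ^+ d; set v := (1 - eta) ^+ d; nra.
by rewrite /M exprMn ler_pM2r.
Qed.

Let M_expr_pred : M ^+ d.-1 <= 4 * eps.
Proof.
have := M_expr; rewrite -{1}(prednK (leq_ltn_trans (leq0n 14) d15)) exprS.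
have : 0 <= M ^+ d.-1 by rewrite exprn_ge0// /M; have := eta_ge0; lra.
by rewrite {2 4}/M; have := eta_ge0; nra.
Qed.

Let arg_itv F i : box 4 F ->
  0 <= 1 - (F (- i - 3) + F (- i - 1)) / 2 <= if i < 0 then M else 1.
Proof.
move=> [F01 _ Fp]; have := F01 (- i - 3); have := F01 (- i - 1) => ? ?.
case: ifP => i0; last by lra.
(* Only [- i - 1] is sure to be nonnegative: for [i] equal to -1 or -2 the index [- i - 3] is
   negative, and its term is bounded by 1. Hence the mean [M] of 1 and [eta]. *)
by have := Fp (- i - 1) ltac:(lia); rewrite /M /eta; lra.
Qed.

(** The constant drops from 4 to 2; this gain is the room used for stability. *)
Lemma Q_lt0_le F i : box 4 F -> i < 0 -> Q F i <= 2 * eps.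
Proof.
move=> bF i0; have := arg_itv i bF; rewrite i0 => /andP[x0 xM].
by apply: le_trans M_expr; rewrite QE lerXn2r ?nnegrE// (le_trans x0).
Qed.

Lemma Q_ge0_ge F i c : box 4 F -> (forall i, i < 0 -> F i <= c * eps) -> 0 <= i ->
  1 - Q F i <= c * d%:R * eps.
Proof.
move=> [F01 _ _] Fc i0; have := F01 (- i - 3); have := F01 (- i - 1) => ? ?.
have h1 := Fc (- i - 3) ltac:(lia); have h2 := Fc (- i - 1) ltac:(lia).
rewrite QE; apply: (le_trans (one_sub_expr_le _ _)); first lra.
by have := dR; nra.
Qed.

Lemma Q_box F : box 4 F -> box 4 (Q F).
Proof.
move=> bF; have [F01 FN _] := bF; split; first exact: Q_itv.
- move=> i i0; apply: (le_trans (Q_lt0_le bF i0)); have := eps_gt0; lra.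
- by move=> i; exact: Q_ge0_ge.
Qed.

Lemma iter_Q_box n F : box 4 F -> box 4 (iter n Q F).
Proof. by move=> bF; elim: n => //= n; exact: Q_box. Qed.

(** The first application gains the constant 2 at the negative integers, the second carries it over
    to the others. *)
Lemma QQ_box F : box 4 F -> box 2 (Q (Q F)).
Proof.
move=> bF; have bQ := Q_box bF; split.
- by apply: Q_itv; case: bQ.
- by move=> i; exact: Q_lt0_le.
- by move=> i; apply: Q_ge0_ge => // j; exact: Q_lt0_le.
Qed.

Lemma Q_close D F G : 0 <= D -> box 4 F -> box 4 G -> weighted_close D F G ->
  weighted_close (D / 2) (Q F) (Q G).
Proof.
move=> D0 bF bG [FGN FGP].
have dE := prednK (leq_ltn_trans (leq0n 14) d15).
have D2 : D / (2 * d%:R) <= D.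
  by rewrite ler_pdivrMr; have := dR; nra.
have FG i : `|F i - G i| <= D.
  by have [/FGP//|/FGN/le_trans->] := leP 0 i.
have lip i : `|Q F i - Q G i| <= d%:R * (if i < 0 then M else 1) ^+ d.-1 *
    ((`|F (- i - 3) - G (- i - 3)| + `|F (- i - 1) - G (- i - 1)|) / 2).
  rewrite !QE -{1 2}dE.
  apply: (le_trans (expr_lipschitz _ (arg_itv i bF) (arg_itv i bG))).
  rewrite dE ler_wpM2l ?mulr_ge0 ?exprn_ge0//.
    by case: ifP => _; rewrite ?/M; have := eta_ge0; lra.
  rewrite (_ : _ - _ = - ((F (- i - 3) - G (- i - 3)) + (F (- i - 1) - G (- i - 1))) / 2); last by lra.
  by rewrite normrM normrN [`|2^-1|]ger0_norm// ler_wpM2r// ler_normD.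
split=> i i0; apply: (le_trans (lip i)).
- rewrite i0; have := FG (- i - 3); have := FG (- i - 1).
  set x := `|_|; set y := `|_|; move=> xD yD.
  have xy : (y + x) / 2 <= D by lra.
  (* The Lipschitz constant is [d%:R * M ^+ d.-1]; reaching [D / 2 / (2 * d%:R)] then amounts to
     [16 * d%:R ^+ 2 * eps <= 1]. *)
  apply: (@le_trans _ _ (d%:R * (4 * eps) * D)).
    rewrite ler_pM ?mulr_ge0 ?exprn_ge0 ?addr_ge0 ?normr_ge0//.
      by rewrite /M; have := eta_ge0; lra.
    by rewrite ler_wpM2l.
  rewrite ler_pdivlMr; last by have := dR; lra.
  by have := sqr_eps_small; rewrite expr2; nra.
- have -> : (i < 0) = false by lia.
  (* Both arguments are negative, where the weight [2 * d%:R] compensates the Lipschitz constant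
     [d%:R]. *)
  have := FGN (- i - 3) ltac:(lia); have := FGN (- i - 1) ltac:(lia).
  set x := `|_|; set y := `|_|; move=> xD yD.
  rewrite expr1n mulr1; apply: (@le_trans _ _ (d%:R * (D / (2 * d%:R)))).
    by rewrite ler_wpM2l//; lra.
  have d0 : d%:R != 0 :> R by have := dR; lra.
  by rewrite (_ : _ * _ = D / 2)//; field.
Qed.

Lemma iter_Q_close n F G : box 4 F -> box 4 G ->
  forall i, `|iter n Q F i - iter n Q G i| <= 2 * d%:R * 2^-1 ^+ n.
Proof.
move=> bF bG.
suff : weighted_close (2 * d%:R * 2^-1 ^+ n) (iter n Q F) (iter n Q G).
  move=> [hN hP] i; have [/hP//|/hN/le_trans->//] := leP 0 i.
  have e0 : 0 <= (2^-1 : R) ^+ n by rewrite exprn_ge0//; lra.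
  by rewrite mulrAC mulfV ?mul1r; have := dR; nra.
(* Initially [D = 2 * d%:R], so that even the weighted bound is 1, valid for any two functions into
   [0, 1]. *)
elim: n => [|n IHn] /=.
  have [F01 _ _] := bF; have [G01 _ _] := bG; rewrite expr0 mulr1.
  have FG i : `|F i - G i| <= 1.
    by have := F01 i; have := G01 i; rewrite ler_norml; lra.
  have d0 : 2 * d%:R != 0 :> R by have := dR; lra.
  by split=> i _; rewrite (le_trans (FG i)) ?mulfV//; have := dR; lra.
rewrite exprSr mulrA; by apply: Q_close => //; exact: iter_Q_box.
Qed.

Lemma geometric_cvg (u : nat -> R) (l : R) :
  (forall n, `|u n - l| <= 2 * d%:R * 2^-1 ^+ n) -> u n @[n --> \oo] --> l.
Proof.
move=> ul; have c0 : 0 < 2 * d%:R :> R by have := dR; lra.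
apply/cvgrPdist_lt => e e0.
have [N Ne] := @expr_arbitrarily_small R 2^-1 (e / (2 * d%:R)) ltac:(lra) (divr_gt0 e0 c0).
exists N => // n /= Nn; rewrite distrC; apply: (le_lt_trans (ul n)).
rewrite mulrC -ltr_pdivlMr//; apply: le_lt_trans Ne.
by rewrite ler_wiXn2l//; lra.
Qed.

(** * The fixed point as a limit of iterates *)

Definition heaviside (i : int) : R := ((0 <= i)%R)%:R.

Lemma heaviside_box : box 4 heaviside.
Proof.
have := eps_gt0; have := dR => ? ?.
split=> i; rewrite /heaviside; first by case: (0 <= i); rewrite ?ler01 ?lexx.
- by move=> i0; rewrite (leNgt 0 i) i0 /= mulr_ge0//; lra.
- by move=> ->; rewrite subrr !mulr_ge0//; lra.
Qed.

Lemma is_cvg_iter_Q i : cvg (iter n Q heaviside i @[n --> \oo]).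
Proof.
apply/cauchy_cvgP/cauchy_exP => e e0.
have c0 : 0 < 2 * d%:R :> R by have := dR; lra.
have [N Ne] := @expr_arbitrarily_small R 2^-1 (e / (2 * d%:R)) ltac:(lra) (divr_gt0 e0 c0).
exists (iter N Q heaviside i), N => // n /= Nn.
(* The n-th iterate is the N-th iterate started from another point of the box, so contraction gives
   the Cauchy property. *)
rewrite /ball/= distrC -(subnKC Nn) iterD.
apply: (le_lt_trans (iter_Q_close _ (iter_Q_box _ heaviside_box) heaviside_box i)).
by rewrite mulrC -ltr_pdivlMr.
Qed.

(** The limit is taken along all iterates of [Q], not only the even ones, so that it is fixed by [Q]
    and not merely by [Psi]. *)
Definition F_lim (i : int) : R := limn (fun n => iter n Q heaviside i).

Lemma F_lim_cvg i : iter n Q heaviside i @[n --> \oo] --> F_lim i.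
Proof. exact: is_cvg_iter_Q. Qed.

Lemma F_lim_fixed : Q F_lim = F_lim.
Proof.
apply/funext => i.
have step : iter n.+1 Q heaviside i @[n --> \oo] --> F_lim i.
  by rewrite (cvg_shiftS (fun n => iter n Q heaviside i)); exact: F_lim_cvg.
suff h : iter n.+1 Q heaviside i @[n --> \oo] --> Q F_lim i.
  exact: (cvg_unique (@Rhausdorff R) h step).
rewrite QE; under eq_fun do rewrite iterS QE.
pose l (G : int -> R) := 1 - (G (- i - 3) + G (- i - 1)) / 2.
suff ul : l (iter n Q heaviside) @[n --> \oo] --> l F_lim.
  exact: (cvg_comp _ _ ul (@exprn_continuous R d (l F_lim))).
apply: (@cvgB _ R^o); first exact: cvg_cst.
apply: (@cvgM R _ _ _ _ _ _ 2^-1); last exact: cvg_cst.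
by apply: (@cvgD _ R^o); exact: F_lim_cvg.
Qed.

Lemma F_lim_box : box 4 F_lim.
Proof.
have bn n := iter_Q_box n heaviside_box.
split=> i.
- rewrite (limr_ge (@is_cvg_iter_Q i)) ?(limr_le (@is_cvg_iter_Q i))//;
    by near=> n; have [+ _ _] := bn n; move=> /(_ i)/andP[].
- move=> i0; apply: (limr_le (@is_cvg_iter_Q i)).
  by near=> n; have [_ + _] := bn n; exact.
- move=> i0; rewrite lerBlDr -lerBlDl; apply: (limr_ge (@is_cvg_iter_Q i)).
  by near=> n; rewrite lerBlDl -lerBlDr; have [_ _ +] := bn n; exact.
Unshelve. all: by end_near. Qed.

Lemma F_lim_nondecreasing : {homo F_lim : i j / i <= j}.
Proof.
have Fm n : {homo iter n Q heaviside : i j / i <= j}.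
  elim: n => [|n IHn] i j ij /=; last first.
    by apply: Q_nondecreasing => //; have [] := iter_Q_box n heaviside_box.
  by rewrite /heaviside ler_nat; lia.
move=> i j ij; apply: (ler_lim (@is_cvg_iter_Q i) (@is_cvg_iter_Q j)).
by near=> n; exact: Fm.
Unshelve. all: by end_near. Qed.

(** The box does not give the limits at infinity; the fixed-point equation does, by making the left
    tail decay geometrically and controlling the right tail by it. *)
Lemma F_lim_shape : cdf_shape F_lim.
Proof.
have bF := F_lim_box; have [F01 FN FP] := bF.
have Fm := F_lim_nondecreasing.
have F_ge0 j : 0 <= j -> 1 - F_lim j <= d%:R * F_lim (- j - 1).
  move=> j0; rewrite -{1}F_lim_fixed QE.
  have := F01 (- j - 3); have := F01 (- j - 1) => ? ?.
  apply: (le_trans (one_sub_expr_le _ _)); first lra.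
  have := Fm (- j - 3) (- j - 1) ltac:(lia).
  by have := dR; nra.
have FD j : 0 <= j -> F_lim (- j - 3) <= F_lim (- j - 1) / 2.
  move=> j0; rewrite -{1}F_lim_fixed QE.
  have -> : - (- j - 3) - 3 = j :> int by lia.
  have -> : - (- j - 3) - 1 = j + 2 :> int by lia.
  have := F01 j; have := F01 (j + 2) => ? ?.
  have := Fm j (j + 2) ltac:(lia) => ?.
  (* Of the [d] factors two suffice: one is at most [eta], the other at most
     [d%:R * F_lim (- j - 1)], and [d%:R * eta <= 4^-1]. *)
  apply: (@le_trans _ _ ((1 - F_lim j) ^+ 2)).
    apply: (@le_trans _ _ ((1 - F_lim j) ^+ d)); first by rewrite lerXn2r ?nnegrE; lra.
    by rewrite ler_wiXn2l//; [lra|lra|exact: leq_trans d15].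
  have := F_ge0 j j0; have := FP j j0; rewrite -/eta => ? ?.
  have := deta; have := F01 (- j - 1); rewrite expr2; set x := F_lim (- j - 1).
  move=> x01 ?.
  apply: (@le_trans _ _ (eta * (d%:R * x))); first by rewrite ler_pM//; lra.
  by nra.
have F_small k : F_lim (- (2 * k%:Z) - 1) <= 2^-1 ^+ k.
  elim: k => [|k IHk]; first by have := F01 (- (2 * 0%:Z) - 1); rewrite expr0; lra.
  have := FD (2 * k%:Z) ltac:(lia).
  have -> : - (2 * k.+1%:Z) - 1 = - (2 * k%:Z) - 3 by lia.
  by rewrite exprS; lra.
split=> // e e0.
- have [k ke] := @expr_arbitrarily_small R 2^-1 e ltac:(lra) e0.
  by exists (- (2 * k%:Z) - 1); exact: le_lt_trans ke.
- have d0 : 0 < d%:R :> R by have := dR; lra.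
  have [k ke] := @expr_arbitrarily_small R 2^-1 (e / d%:R) ltac:(lra) (divr_gt0 e0 d0).
  exists (2 * k%:Z); rewrite ltrBlDr -ltrBlDl.
  apply: (le_lt_trans (F_ge0 (2 * k%:Z) ltac:(lia))).
  by rewrite mulrC -ltr_pdivlMr//; apply: le_lt_trans ke.
Qed.

Lemma F_lim_Phi' : Phi' d F_lim = R_map F_lim.
Proof. by rewrite -{2}F_lim_fixed /Q R_mapK. Qed.

Lemma F_lim_Psi : Psi d F_lim = F_lim.
Proof. by rewrite Psi_QQ !F_lim_fixed. Qed.

Lemma iter_Psi_cvg G : box 4 G -> weak_cvg (fun n => iter n (Psi d) G) F_lim.
Proof.
move=> bG i; apply: geometric_cvg => n; rewrite iter_Psi.
have -> : F_lim i = iter n.*2 Q F_lim i.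
  by congr (_ i); elim: n.*2 => //= k <-; rewrite F_lim_fixed.
apply: (le_trans (iter_Q_close _ bG F_lim_box i)).
rewrite ler_wpM2l// ler_wiXn2l//; first lra.
by rewrite -addnn leq_addr.
Qed.

(** [F_lim] lies in the smaller box [box 2], so every [G] within [eps] of it lies in [box 4], where
    the contraction applies. *)
Lemma F_lim_stable : stable d F_lim.
Proof.
exists eps; first exact: eps_gt0.
move=> G Gev Gclose; apply: iter_Psi_cvg.
have [_ G01 _ _] := is_cdf_on_shape Gev.
have [F01 FN FP] : box 2 F_lim.
  by rewrite -F_lim_Psi Psi_QQ; exact: QQ_box F_lim_box.
have GF i : `|G i - F_lim i| < eps.
  (* The differences are bounded by 1, so [sup] is a genuine supremum and not a default value. *)
  apply: le_lt_trans Gclose; apply: sup_ubound; last by exists i.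
  exists 1 => _ [j _ <-]; have := G01 j; have := F01 j; rewrite ler_norml; lra.
have := eps_gt0; have := dR => ? ?.
split=> // i i0; have := GF i; rewrite ltr_norml.
- by have := FN i i0; lra.
- by have := FP i i0; nra.
Qed.

End ReflectedMap.

(** * The law of the value of the game *)

Section SignAverage.
Variables (R : realType) (E : eqType).
Implicit Types (s : seq E) (f g : (E -> bool) -> R) (sg : E -> bool).

Definition update sg (e : E) (b : bool) : E -> bool :=
  fun e' => if e' == e then b else sg e'.

(** The expectation of [f] when the signs on [s] are independent fair coins and all others are
    frozen at [sg]. *)
Fixpoint avg s f sg : R :=
  if s is e :: s' then
    (avg s' f (update sg e true) + avg s' f (update sg e false)) / 2
  else f sg.

Lemma avg_cat s1 s2 f sg : avg (s1 ++ s2) f sg = avg s1 (avg s2 f) sg.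
Proof. by elim: s1 sg => //= e s1 IHs sg; rewrite !IHs. Qed.

Lemma eq_avg_in s f g sg :
  (forall sg', (forall e, e \notin s -> sg' e = sg e) -> f sg' = g sg') ->
  avg s f sg = avg s g sg.
Proof.
elim: s sg => [|e s IHs] sg fg /=; first exact: fg.
congr ((_ + _) / 2); apply: IHs => sg' sg'E; apply: fg => e';
  by rewrite inE negb_or => /andP[e'e /sg'E]; rewrite /update (negbTE e'e).
Qed.

Lemma avgZ s (c : R) f sg : avg s (fun sg' => c * f sg') sg = c * avg s f sg.
Proof. by elim: s sg => //= e s IHs sg; rewrite !IHs; lra. Qed.

Lemma avgC s f sg : avg s (fun sg' => 1 - f sg') sg = 1 - avg s f sg.
Proof. by elim: s sg => //= e s IHs sg; rewrite !IHs; lra. Qed.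

(** Independence of disjoint blocks: while the other blocks are averaged, [g j] stays constant and
    factors out. *)
Lemma avg_prod (I : eqType) (l : I -> seq E) (g : I -> (E -> bool) -> R)
    (q : R) (js : seq I) sg :
  uniq js ->
  (forall i j e, i != j -> e \in l i -> e \notin l j) ->
  (forall j sg1 sg2, (forall e, e \in l j -> sg1 e = sg2 e) ->
     g j sg1 = g j sg2) ->
  (forall j sg', avg (l j) (g j) sg' = q) ->
  avg (flatten [seq l j | j <- js]) (fun sg' => \prod_(j <- js) g j sg') sg =
  q ^+ size js.
Proof.
move=> + ldisj gl gq; elim: js sg => [|j js IHjs] sg /=; first by rewrite big_nil.
move=> /andP[jjs ujs]; rewrite avg_cat exprSr -[X in _ * X](gq j sg) -avgZ.
apply: eq_avg_in => sg1 _; rewrite -(IHjs sg1 ujs) mulrC -avgZ.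
apply: eq_avg_in => sg2 sg2E; rewrite big_cons; congr (_ * _).
apply: gl => e ej; apply: sg2E; apply/negP => /flatten_mapP[i ijs ei].
have ji : j != i by apply: contra jjs => /eqP->.
by have := ldisj j i e ji ej; rewrite ei.
Qed.

End SignAverage.

Lemma uniq_flatten_map (I E : eqType) (l : I -> seq E) (js : seq I) :
  uniq js -> (forall j, uniq (l j)) ->
  (forall i j e, i != j -> e \in l i -> e \notin l j) ->
  uniq (flatten [seq l j | j <- js]).
Proof.
move=> + ul ldisj; elim: js => //= j js IHjs /andP[jjs /IHjs ujs].
rewrite cat_uniq ul ujs andbT; apply/hasPn => e /flatten_mapP[i ijs ei] /=.
by apply: (ldisj i j e) => //; apply: contra jjs => /eqP<-.
Qed.

Section SeqExtrema.
Variable R : realType.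
Implicit Types (s : seq R) (x : R).

Lemma seq_max_le s x : (0 < size s)%N -> (seq_max s <= x) = all (fun y => y <= x) s.
Proof.
case: s => // y s _; rewrite /seq_max [head _ _]/=.
have bigE s' : (\big[Num.max/y]_(z <- s') z <= x) = all (fun z => z <= x) s' && (y <= x).
  by elim: s' => [|z s' IHs]; rewrite ?big_nil// big_cons ge_max IHs andbA.
by rewrite bigE /=; case: (y <= x); rewrite ?andbF ?andbT.
Qed.

Lemma lt_seq_min s x : (0 < size s)%N -> (x < seq_min s) = all (fun y => x < y) s.
Proof.
case: s => // y s _; rewrite /seq_min [head _ _]/=.
have bigE s' : (x < \big[Num.min/y]_(z <- s') z) = all (fun z => x < z) s' && (x < y).
  by elim: s' => [|z s' IHs]; rewrite ?big_nil// big_cons lt_min IHs andbA.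
by rewrite bigE /=; case: (x < y); rewrite ?andbF ?andbT.
Qed.

End SeqExtrema.

(** * The game for a deterministic outcome of the cookies *)

Section TreeValue.
Variables (R : realType) (d : nat).
Implicit Types (c : edge d -> R) (v : vertex d) (k : nat) (i : int).

(* [game_value] as a function of an outcome [c] of the cookies, which allows
   random outcomes to be replaced by sign patterns. *)
Fixpoint tree_value c k v : R :=
  if k is k'.+1 then
    let s := [seq c (v, j) + tree_value c k' (rcons v j) | j <- enum 'I_d] in
    if odd (size v) then seq_min s else seq_max s
  else 0.

(** The edges on which the game value depends, grouped by branch so that averages factor over the
    children. *)
Fixpoint edges k v : seq (edge d) :=
  if k is k'.+1 then
    flatten [seq (v, j) :: edges k' (rcons v j) | j <- enum 'I_d]
  else [::].

Lemma edges_prefix k v e : e \in edges k v -> exists w, e.1 = v ++ w.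
Proof.
elim: k v => // k IHk v /= /flatten_mapP[j _]; rewrite inE => /predU1P[->|].
  by exists [::]; rewrite cats0.
by move=> /IHk[w ->]; exists (j :: w); rewrite cat_rcons.
Qed.

(** The letter at position [size v] identifies the branch; for the edge [(v, j)] itself this
    position is out of range, and the default [e.2] returns [j]. *)
Lemma branch_edges_key k v j e : e \in (v, j) :: edges k (rcons v j) ->
  nth e.2 e.1 (size v) = j.
Proof.
rewrite inE => /predU1P[->|/edges_prefix[w ->]] /=; first by rewrite nth_default.
by rewrite cat_rcons nth_cat ltnn subnn.
Qed.

Lemma branch_edges_disjoint k v (j1 j2 : 'I_d) e : j1 != j2 ->
  e \in (v, j1) :: edges k (rcons v j1) -> e \notin (v, j2) :: edges k (rcons v j2).
Proof.
move=> j12 e1; apply/negP => e2; move/negP: j12; apply.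
by rewrite -(branch_edges_key e1) (branch_edges_key e2).
Qed.

Lemma root_edge_notin k v (j : 'I_d) : (v, j) \notin edges k (rcons v j).
Proof.
apply/negP => /edges_prefix[w] /= /(congr1 size).
by rewrite size_cat size_rcons; lia.
Qed.

Lemma edges_uniq k v : uniq (edges k v).
Proof.
elim: k v => //= k IHk v; apply: uniq_flatten_map.
- exact: enum_uniq.
- by move=> j /=; rewrite root_edge_notin IHk.
- by move=> j1 j2 e; exact: branch_edges_disjoint.
Qed.

Lemma eq_tree_value c1 c2 k v :
  (forall e, e \in edges k v -> c1 e = c2 e) ->
  tree_value c1 k v = tree_value c2 k v.
Proof.
elim: k v => //= k IHk v c12.
have -> : [seq c1 (v, j) + tree_value c1 k (rcons v j) | j <- enum 'I_d] =
          [seq c2 (v, j) + tree_value c2 k (rcons v j) | j <- enum 'I_d].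
  apply/eq_in_map => j jd.
  have h e : e \in (v, j) :: edges k (rcons v j) -> c1 e = c2 e.
    by move=> ej; apply: c12; apply/flatten_mapP; exists j.
  rewrite (h _ (mem_head _ _)) (IHk (rcons v j))// => e ej.
  by apply: h; rewrite inE ej orbT.
by [].
Qed.

Definition sign (b : bool) : R := if b then 1 else -1.

(** The CDF of the value with [k] levels left, at a vertex whose height is odd exactly when [o]
    holds. *)
Fixpoint level_cdf k (o : bool) : int -> R :=
  if k is k'.+1 then
    (if o then Phi' d else Phi d) (level_cdf k' (~~ o))
  else heaviside R.

Lemma level_cdf_Psi n : level_cdf n.*2 false = iter n (Psi d) (heaviside R).
Proof. by elim: n => //= n ->. Qed.

(** A cookie +1 moves the threshold for the subtree to [i - 1], a cookie -1 to [i + 1]. *)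
Lemma avg_branch k v j i (p : int -> R) :
  (forall i' sg, avg (edges k (rcons v j))
     (fun sg' => (tree_value (sign \o sg') k (rcons v j) <= i'%:~R)%R%:R) sg = p i') ->
  forall sg, avg ((v, j) :: edges k (rcons v j))
    (fun sg' => (sign (sg' (v, j)) +
       tree_value (sign \o sg') k (rcons v j) <= i%:~R)%R%:R) sg =
  (p (i - 1) + p (i + 1)) / 2.
Proof.
move=> pE sg /=; rewrite -(pE (i - 1) (update sg (v, j) true)).
rewrite -(pE (i + 1) (update sg (v, j) false)).
congr ((_ + _) / 2); apply: eq_avg_in => sg' /(_ _ (root_edge_notin k v j));
  rewrite /update eqxx => -> /=; congr (nat_of_bool _)%:R;
  rewrite ?intrB ?intrD; apply/idP/idP; lra.
Qed.

Lemma avg_tree_value k v i sg : (0 < d)%N ->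
  avg (edges k v) (fun sg' => (tree_value (sign \o sg') k v <= i%:~R)%R%:R) sg =
  level_cdf k (odd (size v)) i.
Proof.
move=> d0; elim: k v i sg => [|k IHk] v i sg.
  by rewrite /= /heaviside -(ler_int R).
pose l j := (v, j) :: edges k (rcons v j).
pose g j sg : R :=
  (sign (sg (v, j)) + tree_value (sign \o sg) k (rcons v j) <= i%:~R)%R%:R.
pose F := level_cdf k (~~ odd (size v)).
have gE j sg' : avg (l j) (g j) sg' = (F (i - 1) + F (i + 1)) / 2.
  by apply: avg_branch => i' sg''; rewrite IHk size_rcons.
have gl j sg1 sg2 : (forall e, e \in l j -> sg1 e = sg2 e) -> g j sg1 = g j sg2.
  move=> sg12; rewrite /g sg12 ?mem_head//; congr (nat_of_bool (_ + _ <= _)%R)%:R.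
  by apply: eq_tree_value => e ej /=; rewrite sg12// inE ej orbT.
have ldisj j1 j2 e : j1 != j2 -> e \in l j1 -> e \notin l j2.
  exact: branch_edges_disjoint.
have prod_all (a : 'I_d -> bool) :
    \prod_(j <- enum 'I_d) (a j)%:R = (all a (enum 'I_d))%:R :> R.
  elim: (enum 'I_d) => [|j js IHjs]; first by rewrite big_nil.
  by rewrite big_cons IHjs /=; case: (a j); rewrite ?mul1r ?mul0r.
have size_enum : size (enum 'I_d) = d by rewrite size_enum_ord.
have expr_d (q : R) : q ^+ d = q ^+ size (enum 'I_d) by rewrite size_enum.
have uniq_enum := enum_uniq 'I_d.
rewrite /= -/F; case: (odd (size v)).
(* A minimum exceeds [i] when all branches do, so the complementary indicators are multiplied. *)
- rewrite /Phi' expr_d.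
  rewrite -(avg_prod (g := fun j sg' => 1 - g j sg') sg uniq_enum ldisj) -?avgC.
  + apply: eq_avg_in => sg' _; rewrite leNgt lt_seq_min; last by rewrite size_map size_enum.
    rewrite all_map.
    under eq_bigr => j _.
      rewrite (_ : 1 - g j sg' = (i%:~R < sign (sg' (v, j)) +
        tree_value (sign \o sg') k (rcons v j))%R%:R); last first.
        by rewrite /g leNgt; case: ltP => _; rewrite ?subr0 ?subrr.
      over.
    by rewrite prod_all; case: all; rewrite ?subrr ?subr0.
  + by move=> j sg1 sg2 sg12; rewrite (gl j sg1 sg2 sg12).
  + by move=> j sg'; rewrite avgC gE.
(* A maximum is at most [i] when all branches are. *)
- rewrite /Phi expr_d -(avg_prod sg uniq_enum ldisj gl gE).
  apply: eq_avg_in => sg' _; rewrite seq_max_le; last by rewrite size_map size_enum.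
  rewrite all_map.
  by rewrite -prod_all.
Qed.

End TreeValue.

(** * Transfer to random cookies *)

Section Cookies.
Context (R : realType) (d : nat) (disp : measure_display)
  (T : measurableType disp) (P : probability T R) (X : edge d -> {RV P >-> R}).
Implicit Types (r s : seq (edge d)) (sg : edge d -> bool).

Lemma game_valueE k v t : game_value X k v t = tree_value (X ^~ t) k v.
Proof.
elim: k v => //= k IHk v.
have -> : [seq X (v, j) t + game_value X k (rcons v j) t | j <- enum 'I_d] =
    [seq X (v, j) t + tree_value (X ^~ t) k (rcons v j) | j <- enum 'I_d].
  by apply: eq_map => j; rewrite IHk.
by [].
Qed.

Hypothesis X_iid : iid_cookies X.

Definition cylinder r sg : set T :=
  [set t | forall e, e \in r -> X e t = sign R (sg e)].

Let prob_sign e b : P (X e @^-1` [set sign R b]) = (2^-1)%:E.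
Proof. by have [_ /(_ e)[Xp Xm]] := X_iid; case: b. Qed.

Lemma measurable_cylinder r sg : measurable (cylinder r sg).
Proof.
have -> : cylinder r sg =
    \bigcap_(e in [set` r]) (X e @^-1` [set sign R (sg e)]) by [].
by apply: fin_bigcap_measurable => [|e _]; [exact: finite_seq|exact: measurable_funPTI].
Qed.

Lemma prob_cylinder r sg : uniq r -> P (cylinder r sg) = (2^-1 ^+ size r)%:E.
Proof.
move=> ur; have [Xind _] := X_iid.
have := Xind r (fun e => [set sign R (sg e)]) ur (fun=> measurable_set1 _).
rewrite -/(cylinder r sg) => ->.
elim: r {ur} => [|e r IHr]; first by rewrite big_nil expr0.
by rewrite big_cons IHr /= prob_sign exprS EFinM.
Qed.

(** The cookies take the values 1 and -1 only almost surely; the remaining outcomes are null because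
    the two masses add up to 1. *)
Let prob_split e (B : set T) : measurable B ->
  P B = (P (B `&` X e @^-1` [set sign R true]) +
         P (B `&` X e @^-1` [set sign R false]))%E.
Proof.
move=> mB; have mX b : measurable (X e @^-1` [set sign R b]).
  exact: measurable_funPTI.
set U := X e @^-1` [set sign R true]; set W := X e @^-1` [set sign R false].
have UW : U `&` W = set0.
  rewrite -subset0 => t [].
  by change (X e t = 1 -> X e t = -1 -> False) => ->; lra.
have PUW : P (U `|` W) = 1%E.
  rewrite measureU ?UW//; [|exact: mX|exact: mX].
  apply: (etrans (congr2 adde (prob_sign e true) (prob_sign e false))).
  by change ((2^-1 + 2^-1)%:E = 1%:E :> \bar R); congr _%:E; lra.
rewrite -measureU; first last.
- by rewrite setIACA UW setI0.
- by apply: measurableI => //; exact: mX.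
- by apply: measurableI => //; exact: mX.
have mUW : measurable (U `|` W) by apply: measurableU; exact: mX.
rewrite -setIUr.
have BUW0 : P (B `\` (U `|` W)) = 0.
  apply/eqP; rewrite eq_le measure_ge0 andbT.
  have <- : P (~` (U `|` W)) = 0 by rewrite probability_setC// PUW subee.
  by apply: le_measure; rewrite ?inE; [exact: measurableD|exact: measurableC|move=> t []].
apply: (etrans (measureDI P mB mUW)).
exact: (etrans (congr2 adde BUW0 erefl) (add0e _)).
Qed.

(* Exposing the signs of the edges of s one at a time reduces the probability
   of an event to an average over sign patterns. *)
Lemma prob_cylinder_avg s r sg (A : set T) (a : (edge d -> bool) -> bool) :
  measurable A -> uniq (s ++ r) ->
  (forall sg' t, cylinder (s ++ r) sg' t -> A t <-> a sg') ->
  P (A `&` cylinder r sg) =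
  (2^-1 ^+ size r * avg s (fun sg' => (a sg')%:R) sg)%:E.
Proof.
move=> mA; elim: s r sg => [|e s IHs] r sg usr Aa /=.
  have -> : A `&` cylinder r sg = if a sg then cylinder r sg else set0.
    apply/seteqP; split=> [t [At rt]|t]; first by have -> := (Aa sg t rt).1 At.
    by case: ifP => // asg rt; split=> //; exact/(Aa sg t rt).
  case: (a sg); last by rewrite measure0 mulr0.
  by rewrite prob_cylinder// mulr1.
have usr' : uniq (s ++ e :: r).
  by rewrite (perm_uniq (permEl (perm_catCA s [:: e] r))).
have er : e \notin r.
  by move: usr' ; rewrite cat_uniq => /and3P[_ _ /andP[]].
have cyl_update b : A `&` cylinder r sg `&` X e @^-1` [set sign R b] =
    A `&` cylinder (e :: r) (update sg e b).
  rewrite -setIA; congr (_ `&` _); apply/seteqP; split=> t.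
    move=> [rt /= et] e'; rewrite inE /update; case: eqP => [-> //|_ /=].
    exact: rt.
  move=> ert; split=> [e' e'r|]; last by rewrite /= ert ?mem_head// /update eqxx.
  rewrite ert ?inE ?e'r ?orbT// /update; case: eqP => // e'e.
  by rewrite -e'e e'r in er.
have step b : P (A `&` cylinder (e :: r) (update sg e b)) =
    (2^-1 ^+ (size r).+1 * avg s (fun sg' => (a sg')%:R) (update sg e b))%:E.
  apply: IHs => // sg' t srt; apply: Aa => e' e'in; apply: srt.
  by move: e'in; rewrite !(mem_cat, inE) orbCA orbA.
rewrite (prob_split e); last by apply: measurableI => //; exact: measurable_cylinder.
by rewrite !cyl_update !step -EFinD exprSr; congr _%:E; lra.
Qed.

Lemma cdf_VE n i : (0 < d)%N -> cdf_V X n i = iter n (Psi d) (heaviside R) i.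
Proof.
move=> d0; rewrite -level_cdf_Psi -(avg_tree_value R n.*2 [::] i (fun=> true) d0).
pose A := V X n @^-1` `]-oo, i%:~R].
have mA : measurable A by rewrite -[A]setTI; exact: measurable_V.
pose a sg := tree_value (sign R \o sg) n.*2 [::] <= i%:~R.
suff PA : P A = (avg (edges n.*2 [::]) (fun sg => (a sg)%:R) (fun=> true))%:E.
  exact: (congr1 fine PA).
(* No edge is exposed at the start, and the cylinder over the empty list is the whole space. *)
have := @prob_cylinder_avg (edges n.*2 [::]) [::] (fun=> true) A a mA.
rewrite [cylinder _ _](_ : _ = setT) ?setIT; last by apply/seteqP; split.
rewrite cats0 expr0 mul1r; apply; first exact: edges_uniq.
move=> sg t st; rewrite /A /a /= in_itv/= /V game_valueE.
by rewrite (@eq_tree_value _ _ _ (sign R \o sg)).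
Qed.

End Cookies.

(** * The limiting law and the three assertions *)

Lemma F_lim_limiting (R : realType) d : (15 <= d)%N ->
  is_limiting_cdf d (F_lim R d).
Proof.
move=> d15; split; first exact/cdf_shape_is_cdf/F_lim_shape.
move=> disp T P X X_iid i.
under eq_fun do rewrite (cdf_VE X_iid _ _ (leq_ltn_trans (leq0n 14) d15)).
exact: (iter_Psi_cvg d15 (heaviside_box R d15)).
Qed.

Theorem theorem1p4 (R : realType) :
  (* (i) *)
  ((exists F : R -> int -> R,
      (forall i : int, {within `]0, 1[, continuous (fun a : R => F a i)}) /\
      (forall a : R, 0 < a < 1 ->
         [/\ is_even_cdf (F a), Psi 2 (F a) = F a, F a 0 = a,
             Phi' 2 (F a) = S_map (F a) & Phi 2 (F a) = S_inv (F a)] /\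
         (forall G : int -> R, is_even_cdf G -> Psi 2 G = G -> G 0 = a ->
            Phi' 2 G = S_map G -> G = F a))) /\
   (forall G : int -> R, is_even_cdf G -> Psi 2 G = G ->
      (Phi' 2 G = S_map G <-> Phi 2 G = S_inv G))) /\
  (* (ii) *)
  (forall d : nat, (3 <= d)%N ->
     ~ exists F : int -> R, [/\ is_cdf F, Psi d F = F & Phi' d F = S_map F]) /\
  (* (iii) *)
  (exists Finf : nat -> int -> R,
     (forall d : nat, (15 <= d)%N ->
        [/\ is_limiting_cdf d (Finf d), is_cdf (Finf d),
            Psi d (Finf d) = Finf d & Phi' d (Finf d) = R_map (Finf d)]) /\
     (exists d0 : nat, (15 <= d0)%N /\
        forall d : nat, (d0 <= d)%N -> stable d (Finf d))).
Proof.
split; [split|split].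
- exists (fun a i => up_orbit a (i %/ 2)%Z); split.
    by move=> i; apply: continuous_subspaceT => a; exact: continuous_up_orbit.
  move=> a a01; set F := fun i => up_orbit a (i %/ 2)%Z.
  have FPhi : Phi 2 F = S_inv F by exact: up_orbit_half_Phi.
  have FPhi' : Phi' 2 F = S_map F by exact/Phi'2_S_mapE.
  have FPsi : Psi 2 F = F.
    rewrite Psi_S_map_Phi// FPhi; apply/funext => i.
    by rewrite /S_map /S_inv addrK.
  split; last by move=> G Gev _ G0 /Phi'2_S_mapE; exact: even_S_inv_up_orbit.
  split=> //; apply: cdf_shape_is_cdf_on => //.
  - by apply: cdf_shape_half; exact: up_orbit_shape.
  - by move=> i; rewrite /F mulKz.
- by move=> G _ _; exact: Phi'2_S_mapE.
- move=> d d3 [F [Fcdf FPsi FS]].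
  exact: (no_cdf_fixed_S_map d3 (is_cdf_on_shape Fcdf) FPsi FS).
- exists (F_lim R); split=> [d d15|].
    split; [exact: F_lim_limiting|exact/cdf_shape_is_cdf/F_lim_shape|
      exact: F_lim_Psi|exact: F_lim_Phi'].
  by exists 15; split=> // d d15; exact: F_lim_stable.
Qed.
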